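(* The following sets are not MICP-R: (1) the set $\{X\in\mathbb{R}^{m\times n} : \operatorname{rank}(X)\le 1\}$ of $m\times n$ matrices with rank at most $1$, for $m,n\ge 2$ (viewed as a subset of $\mathbb{R}^{mn}$); (2) the complement $\mathbb{R}^n\setminus K$ of a strictly convex body $K\subseteq\mathbb{R}^n$; (3) the spherical shell $\{x\in\mathbb{R}^n : 1\le\|x\|_2\le 2\}$; (4) the set $\bigcup_{i\in\mathbb{Z}}\{(i,i^2),(i+1,(i+1)^2)\}\subseteq\mathbb{R}^2$ of integer points in the parabola, and also its piecewise linear interpolation given by $\bigcup_{i\in\mathbb{Z}}\operatorname{conv}(\{(i,i^2),(i+1,(i+1)^2)\})\subseteq\mathbb{R}^2$.
   Context: Let $N\in\mathbb{N}=\{1,2,\dots\}$ and $p,d\in\mathbb{Z}_+=\{0,1,2,\dots\}$. A closed convex set $M\subseteq\mathbb{R}^{N+p+d}$ (together with $d$) induces an MICP formulation of $S\subseteq\mathbb{R}^N$ if for every $x\in\mathbb{R}^N$: $x\in S$ if and only if there exist $y\in\mathbb{R}^p$, $z\in\mathbb{Z}^d$ with $(x,y,z)\in M$. The set $S$ is MICP-R (mixed-integer convex representable) if such $p,d,M$ exist. A convex body is a full-dimensional compact convex set; it is strictly convex if any strict convex combination of two (distinct) points in the set lies in the interior of the set. $\operatorname{conv}$ denotes the convex hull and $\|\cdot\|_2$ the Euclidean norm.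
   Formalization: In (2) and (3) the dimension n is assumed to be at least 2; for n = 1 the claims are false, since [-2,-1] ∪ [1,2] and the complement of a compact interval are MICP-R. *)

(* Defs.v *)
From HB Require Import structures.
From mathcomp Require Import all_boot all_order all_algebra.
From mathcomp Require Import all_classical all_reals all_analysis.

Set Implicit Arguments.
Unset Strict Implicit.
Unset Printing Implicit Defensive.

Import Order.TTheory GRing.Theory Num.Theory.
Import numFieldNormedType.Exports.

Local Open Scope classical_set_scope.
Local Open Scope ring_scope.

(* Points of R^n are row vectors.  The topology on 'rV[R]_n is the product
   topology, i.e. the usual one. *)

Definition MICP_formulation (R : realType) (N p d : nat)
    (M : set 'rV[R]_(N + p + d)) (S : set 'rV[R]_N) : Prop :=
  forall x : 'rV[R]_N,
    S x <-> exists (y : 'rV[R]_p) (z : 'rV[int]_d),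
              M (row_mx (row_mx x y) (map_mx intr z)).

Definition MICP_representable (R : realType) (N : nat) (S : set 'rV[R]_N) : Prop :=
  exists (p d : nat) (M : set 'rV[R]_(N + p + d)),
    [/\ closed M, @convex_set R 'rV[R]_(N + p + d) M & MICP_formulation M S].

Definition convex_body (R : realType) (n : nat) (K : set 'rV[R]_n) : Prop :=
  [/\ @convex_set R 'rV[R]_n K, compact K & interior K !=set0].

Definition strictly_convex (R : realType) (n : nat) (K : set 'rV[R]_n) : Prop :=
  forall (x y : 'rV[R]_n) (t : R), K x -> K y -> x <> y -> 0 < t < 1 ->
    interior K (t *: x + (1 - t) *: y).

Definition conv_hull (R : realType) (n : nat) (A : set 'rV[R]_n) : set 'rV[R]_n :=
  smallest (@convex_set R 'rV[R]_n) A.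

(* The library norm on 'rV[R]_n is the sup norm, hence this definition. *)
Definition enorm (R : realType) (n : nat) (x : 'rV[R]_n) : R :=
  Num.sqrt (\sum_(i < n) x ord0 i ^+ 2).

Definition parabola_point (R : realType) (i : int) : 'rV[R]_2 :=
  \row_(j < 2) [:: i%:~R; i%:~R ^+ 2]`_j.

(* Main.v *)
Require Import Defs.
From HB Require Import structures.
From mathcomp Require Import all_boot all_order all_algebra.
From mathcomp Require Import all_classical all_reals all_analysis.
From mathcomp Require Import zify ring lra.

(** All five sets fail to be representable for the same reason: they contain
    many points none of whose pairwise midpoints they contain.
    Suppose that [M] represents [S] with [d] integer variables.  Among more
    than [2 ^ d] points of [S], two have integer witnesses that agree modulo 2;
    the average of these witnesses is again integral, so convexity of [M] puts
    the midpoint of the two points in [S].  Hence [S] is not representable as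
    soon as it has arbitrarily large finite families of points whose pairwise
    midpoints all leave [S] ([midpoint_obstruction]).

    It remains to find such families.
    - Matrices of rank at most 1: the rank-one matrices with entries
      [k ^ (i + j)].  The top left 2 x 2 minor of the midpoint of the [k]-th
      and the [l]-th one is [(k - l) ^ 2 / 4].
    - Complement of a strictly convex body [K]: from an interior point of [K],
      follow pairwise non-proportional directions to the points where they
      leave [K].  The finitely many midpoints are interior to [K], so they stay
      in [K] when each point is pushed slightly further along its ray, out of
      [K].  The admissible push depends on the finite family, which is why the
      obstruction is stated for finite families.
    - Spherical shell: distinct points of the unit sphere, whose midpoints have
      norm less than 1 by the parallelogram law.
    - Parabola: the integer points of even abscissa.  Their midpoints have
      integer abscissa and lie strictly above the parabola, hence off the
      piecewise linear interpolation, which meets the parabola there.  One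
      argument thus covers every set between the integer points of the parabola
      and the interpolation.

    The directions in the second item, the factors of the matrices in the first
    and the points of the sphere in the third all come from the moment curve
    [k |-> (1, k, k ^ 2, ...)], any two distinct points of which are
    linearly independent in dimension at least 2. *)

Import Order.TTheory GRing.Theory Num.Theory.
Import numFieldNormedType.Exports.

Set Implicit Arguments.
Unset Strict Implicit.
Unset Printing Implicit Defensive.

Local Open Scope classical_set_scope.
Local Open Scope ring_scope.

(** * Midpoints and the parity obstruction *)

Definition midpoint (R : realType) (N : nat) (x y : 'rV[R]_N) : 'rV[R]_N :=
  2^-1 *: (x + y).

Lemma midpointE (R : realType) (N : nat) (x y : 'rV[R]_N) (j : 'I_N) :
  midpoint x y ord0 j = (x ord0 j + y ord0 j) / 2.
Proof. by rewrite !mxE mulrC. Qed.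

Lemma midpoint_row_mx (R : realType) (N p : nat)
    (x1 x2 : 'rV[R]_N) (y1 y2 : 'rV[R]_p) :
  midpoint (row_mx x1 y1) (row_mx x2 y2) =
  row_mx (midpoint x1 x2) (midpoint y1 y2).
Proof. by rewrite /midpoint add_row_mx scale_row_mx. Qed.

Lemma convex_midpoint (R : realType) (N : nat) (M : set 'rV[R]_N)
    (x y : 'rV[R]_N) :
  @convex_set R 'rV[R]_N M -> M x -> M y -> M (midpoint x y).
Proof.
move=> Mconv /mem_set Mx /mem_set My.
have half_ge0 : 0 <= 2^-1 :> R by lra.
have half_le1 : 2^-1 <= 1 :> R by lra.
have /set_mem := Mconv _ _ (Itv01 half_ge0 half_le1) Mx My.
congr M; rewrite /conv /= /midpoint scalerDr; congr (_ + _ *: _).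
by rewrite /unstable.onem/=; field.
Qed.

Lemma midpoint_same_parity (R : realType) (d : nat) (z1 z2 : 'rV[int]_d) :
  (forall j, (2 %| z1 ord0 j)%Z = (2 %| z2 ord0 j)%Z) ->
  exists z : 'rV[int]_d,
    midpoint (map_mx intr z1) (map_mx intr z2) = map_mx intr z :> 'rV[R]_d.
Proof.
move=> par; exists (\row_j ((z1 ord0 j + z2 ord0 j) %/ 2)%Z).
apply/rowP => j; rewrite midpointE !mxE.
apply: (canLR (mulfK _)); first by rewrite pnatr_eq0.
by rewrite -intrD -[RHS](intrM R _ 2); congr (_%:~R); move: (par j); lia.
Qed.

(** The parity vector of the integer witness takes only [2 ^ d] values, so a
    larger family contains two points with witnesses of the same parity, whose
    midpoint is then witnessed by the midpoint of the witnesses. *)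
Lemma midpoint_obstruction (R : realType) (N : nat) (S : set 'rV[R]_N) :
  (forall k, exists x : 'I_k -> 'rV[R]_N, (forall i, S (x i)) /\
     forall i j, i != j -> ~ S (midpoint (x i) (x j))) ->
  ~ MICP_representable S.
Proof.
move=> scattered [p [d [M [_ Mconv MS]]]].
have [x [Sx midNS]] := scattered #|{ffun 'I_d -> bool}|.+1.
have /choice [yz Myz] i : exists yz : 'rV[R]_p * 'rV[int]_d,
    M (row_mx (row_mx (x i) yz.1) (map_mx intr yz.2)).
  by have [y [z Mxyz]] := (MS (x i)).1 (Sx i); exists (y, z).
pose parity i := [ffun j => (2 %| (yz i).2 ord0 j)%Z].
have /injectivePn[i [j neq_ij par_ij]] : ~~ injectiveb parity.
  by apply/negP => /injectiveP/leq_card; rewrite card_ord ltnn.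
have [z midz] : exists z : 'rV[int]_d,
    midpoint (map_mx intr (yz i).2) (map_mx intr (yz j).2) =
      map_mx intr z :> 'rV[R]_d.
  apply: midpoint_same_parity => l.
  by move/ffunP: par_ij => /(_ l); rewrite !ffunE.
apply: (midNS i j neq_ij); apply/MS.
exists (midpoint (yz i).1 (yz j).1), z.
by rewrite -midz -!midpoint_row_mx; apply: convex_midpoint.
Qed.

Lemma midpoint_obstruction_seq (R : realType) (N : nat) (S : set 'rV[R]_N)
    (x : nat -> 'rV[R]_N) :
  (forall k, S (x k)) ->
  (forall k l, k <> l -> ~ S (midpoint (x k) (x l))) ->
  ~ MICP_representable S.
Proof.
move=> Sx midNS; apply: midpoint_obstruction => k.
exists (fun i => x i); split=> // i j /eqP neq_ij.
by apply: midNS => /ord_inj.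
Qed.

(** * The moment curve *)

Definition moment_vector (R : realType) (n k : nat) : 'rV[R]_n :=
  \row_j k%:R ^+ j.

Lemma moment_vector_neq0 (R : realType) (n k : nat) :
  (0 < n)%N -> moment_vector R n k != 0.
Proof.
move=> n0; apply/eqP => /rowP/(_ (Ordinal n0)).
by rewrite !mxE expr0 => /eqP; rewrite oner_eq0.
Qed.

Lemma moment_vector_independent (R : realType) (n k l : nat) (a b : R) :
  (2 <= n)%N -> a != 0 ->
  a *: moment_vector R n k = b *: moment_vector R n l -> k = l.
Proof.
move=> n2 a0 /rowP eq_ab.
have := eq_ab (Ordinal (ltnW n2)); have := eq_ab (Ordinal n2).
rewrite !mxE /= !expr0 !mulr1 => eq1 eqab; move: eq1; rewrite -eqab.
by move/(mulfI a0)/eqP; rewrite eqr_nat => /eqP.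
Qed.

(** * Matrices of rank at most 1 *)

Lemma rank1_minor (F : fieldType) (m n : nat) (X : 'M[F]_(m, n)) i1 i2 j1 j2 :
  (\rank X <= 1)%N -> X i1 j1 * X i2 j2 = X i1 j2 * X i2 j1.
Proof.
rewrite -{2 3 4 5}(mulmx_base X) !mxE.
move: (col_base X) (row_base X); case: (\rank X) => [|[|//]] u v _.
  by rewrite !big_ord0 !mul0r.
by rewrite !big_ord1; ring.
Qed.

(** On the rows and columns 0 and 1, the midpoint of the [k]-th and [l]-th
    moment matrices is half of [[2, k + l]; [k + l, k ^ 2 + l ^ 2]], which is
    nonsingular unless [k = l]. *)
Lemma rank1_not_MICPR (R : realType) (m n : nat) : (2 <= m)%N -> (2 <= n)%N ->
  ~ MICP_representable
      (mxvec @` [set X : 'M[R]_(m, n) | (\rank X <= 1)%N]).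
Proof.
move=> m2 n2.
pose X k : 'M[R]_(m, n) := (moment_vector R m k)^T *m moment_vector R n k.
apply: (@midpoint_obstruction_seq _ _ _ (fun k => mxvec (X k)))
  => [k|k l neq_kl].
  by exists (X k); rewrite //= mulmx_max_rank.
rewrite /midpoint -linearD -linearZ /= => -[Y /= rY].
move/(can_inj mxvecK) => YE; apply: neq_kl; move: rY.
move/(rank1_minor (Ordinal (ltnW m2)) (Ordinal m2)
        (Ordinal (ltnW n2)) (Ordinal n2)).
rewrite YE !mxE !big_ord1 !mxE /= !expr0 !expr1 => minor0.
apply/eqP; rewrite -(eqr_nat R) -subr_eq0 -sqrf_eq0; apply/eqP; lra.
Qed.

(** * Complements of strictly convex bodies *)

(** The parameters at which the ray meets [K] form a closed bounded set of
    reals, so their supremum is attained; it is positive because [c] is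
    interior. *)
Lemma compact_exit_point (R : realType) (n : nat) (K : set 'rV[R]_n)
    (c u : 'rV[R]_n) :
  compact K -> interior K c -> u != 0 ->
  exists t : R,
    [/\ 0 < t, K (c + t *: u) & forall s, t < s -> ~ K (c + s *: u)].
Proof.
move=> Kcompact Kc u0.
pose ray (t : R) : 'rV[R]_n := c + t *: u.
have ray_cont : continuous ray.
  by move=> t; apply: cvgD; [exact: cvg_cst|apply: cvgZr_tmp; exact: cvg_id].
pose T := ray @^-1` K.
have Tclosed : closed T.
  apply: preimage_closed; first by move=> t _; exact: ray_cont.
  by apply: compact_closed => //; exact: norm_hausdorff.
have T_ub : has_ubound T.
  (* Boundedness gives a bound by every number strictly above some [B]. *)
  have [B [_ /(_ (B + 1) (ltr_pwDr ltr01 (lexx B))) KB]] :=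
    compact_bounded Kcompact.
  exists ((B + 1 + `|c|) / `|u|) => t Tt.
  rewrite ler_pdivlMr ?normr_gt0// -lerBlDr (le_trans _ (KB _ Tt))//.
  rewrite lerBlDr (le_trans (ler_wpM2r (normr_ge0 u) (ler_norm t)))//.
  by rewrite -normrZ -[t *: u](addrK c) [t *: u + c]addrC ler_normB.
have [e e0 Te] : exists2 e : R, 0 < e & T e.
  have T0 : nbhs 0 T by apply: ray_cont; rewrite /ray scale0r addr0.
  have [e [e0 Te]] := filter_ex (filterI (nbhs_right_gt 0) (cvg_within _ T0)).
  by exists e.
exists (sup T); split.
- exact: lt_le_trans e0 (ub_le_sup T_ub Te).
- by apply: Tclosed; apply: closure_sup => //; exists e.
- by move=> s sup_lt Ks; move: sup_lt; rewrite ltNge (ub_le_sup T_ub Ks).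
Qed.

(** The obstruction must be applied to points outside [K], whereas strict
    convexity speaks of points of [K].  The exit points are therefore moved
    outwards by a common amount [e]: all of them leave [K] for every [e > 0],
    while each of the finitely many midpoints remains in [K] for small [e] by
    continuity. *)
Lemma strictly_convex_compl_not_MICPR (R : realType) (n : nat)
    (K : set 'rV[R]_n) : (2 <= n)%N ->
  convex_body K -> strictly_convex K -> ~ MICP_representable (~` K).
Proof.
move=> n2 [_ Kcompact [c Kc]] Kstrict; apply: midpoint_obstruction => k.
pose u i := moment_vector R n i.
have u0 i : u i != 0 by apply: moment_vector_neq0; exact: ltnW.
have /choice [t tP] i := compact_exit_point Kcompact Kc (u0 i).
pose x (e : R) i := c + (t i + e) *: u i.
have mid_near : \forall e \near 0^'+,
    forall ij : 'I_k * 'I_k, ij.1 != ij.2 -> K (midpoint (x e ij.1) (x e ij.2)).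
  apply: filter_forall => -[i j] /=.
  have [->|neq_ij] := eqVneq i j; first exact: nearW.
  have [ti0 Ki _] := tP i; have [tj0 Kj _] := tP j.
  have neq_x : c + t i *: u i <> c + t j *: u j.
    move/addrI/moment_vector_independent => eq_ij; move/eqP: neq_ij; apply.
    by apply/ord_inj/eq_ij => //; rewrite gt_eqF.
  have Kmid : interior K (midpoint (x 0 i) (x 0 j)).
    rewrite /midpoint /x !addr0 scalerDr.
    rewrite [X in _ + X *: _](_ : _ = 1 - 2^-1); last by field.
    by apply: Kstrict => //; lra.
  have mid_cont : continuous (fun e => midpoint (x e i) (x e j)).
    move=> e; apply: cvgZl_tmp; apply: cvgD; apply: cvgD; try exact: cvg_cst;
    by apply: cvgZr_tmp; apply: cvgD; [exact: cvg_cst|exact: cvg_id].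
  rewrite near_withinE; near=> e => _ _; near: e; exact: mid_cont.
have [e [e0 Kmid]] := filter_ex (filterI (nbhs_right_gt 0) mid_near).
exists (x e); split => [i|i j neq_ij]; last by move/(_ (Kmid (i, j) neq_ij)).
by have [_ _] := tP i; apply; rewrite ltrDl.
Unshelve. all: by end_near.
Qed.

(** * The spherical shell *)

Definition sqnorm (R : realType) (n : nat) (x : 'rV[R]_n) : R :=
  \sum_(i < n) x ord0 i ^+ 2.

Lemma sqnorm_ge0 (R : realType) (n : nat) (x : 'rV[R]_n) : 0 <= sqnorm x.
Proof. by apply: sumr_ge0 => i _; exact: sqr_ge0. Qed.

Lemma sqnorm_gt0 (R : realType) (n : nat) (x : 'rV[R]_n) :
  x != 0 -> 0 < sqnorm x.
Proof.
move=> x0; rewrite lt0r sqnorm_ge0 andbT; apply: contraNN x0.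
rewrite psumr_eq0 => [/allP x0|i _]; last exact: sqr_ge0.
apply/eqP/rowP => i; rewrite mxE; apply/eqP.
by rewrite -sqrf_eq0; apply: x0; rewrite mem_index_enum.
Qed.

(** This is the parallelogram law. *)
Lemma sqnorm_midpoint (R : realType) (n : nat) (x y : 'rV[R]_n) :
  sqnorm (midpoint x y) = (sqnorm x + sqnorm y) / 2 - sqnorm (x - y) / 4.
Proof.
rewrite /sqnorm -big_split /= !mulr_suml -sumrB; apply: eq_bigr => i _.
by rewrite midpointE !mxE; field.
Qed.

Lemma shell_not_MICPR (R : realType) (n : nat) : (2 <= n)%N ->
  ~ MICP_representable [set x : 'rV[R]_n | 1 <= enorm x <= 2].
Proof.
move=> n2.
pose u k := moment_vector R n k.
have u0 i : u i != 0 by apply: moment_vector_neq0; exact: ltnW.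
have enorm_u0 k : 0 < enorm (u k) by rewrite sqrtr_gt0 sqnorm_gt0.
pose x k := (enorm (u k))^-1 *: u k.
have sqnormx k : sqnorm (x k) = 1.
  rewrite /sqnorm; under eq_bigr do rewrite mxE exprMn exprVn.
  rewrite -mulr_sumr sqr_sqrtr ?sqnorm_ge0// mulVf//.
  by rewrite gt_eqF// sqnorm_gt0.
apply: (@midpoint_obstruction_seq _ _ _ x) => [k|k l neq_kl].
  by rewrite /= /enorm -/(sqnorm _) sqnormx sqrtr1; apply/andP; split; lra.
have neq_x : x k - x l != 0.
  rewrite subr_eq0; apply/eqP => /moment_vector_independent eq_kl.
  apply: neq_kl.
  by apply: eq_kl => //; rewrite invr_eq0 gt_eqF.
rewrite /= => /andP[+ _]; apply/negP; rewrite -ltNge.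
rewrite -[ltRHS]sqrtr1 ltr_sqrt// -/(sqnorm _) sqnorm_midpoint !sqnormx.
have := sqnorm_gt0 neq_x; lra.
Qed.

(** * Integer points of the parabola *)

(** The line bounding this half-plane passes through the points of the parabola
    of abscissae [i] and [i + 1]. *)
Definition below_chord (R : realType) (i : int) : set 'rV[R]_2 :=
  [set x | x ord0 ord_max <=
             (2 * i%:~R + 1) * x ord0 ord0 - i%:~R * (i%:~R + 1)].

Lemma below_chord_convex (R : realType) (i : int) :
  @convex_set R 'rV[R]_2 (@below_chord R i).
Proof.
move=> x y l /set_mem Bx /set_mem By; apply/mem_set.
move: Bx By; rewrite /below_chord /= /conv /= !mxE /unstable.onem => Bx By.
have l0 : 0 <= l%:num by exact: ge0.
have l1 : 0 <= 1 - l%:num by rewrite subr_ge0 le1.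
have := lerD (ler_wpM2l l0 Bx) (ler_wpM2l l1 By); lra.
Qed.

Lemma conv_hull_below_chord (R : realType) (i : int) :
  conv_hull [set parabola_point R i; parabola_point R (i + 1)] `<=`
  @below_chord R i.
Proof.
apply: smallest_sub; first exact: below_chord_convex.
move=> _ [->|->]; rewrite /below_chord /= !mxE /= ?intrD; lra.
Qed.

(** At the abscissa [k], the chord from [i] to [i + 1] is lower than the
    parabola by [(k - i) * (k - i - 1)], a product of consecutive integers and
    hence nonnegative, even when [k] is not between [i] and [i + 1]. *)
Lemma below_chord_integer (R : realType) (i k : int) (x : 'rV[R]_2) :
  x ord0 ord0 = k%:~R -> below_chord i x -> x ord0 ord_max <= k%:~R ^+ 2.
Proof.
rewrite /below_chord /= => -> /le_trans; apply.
have : 0 <= ((k - i) * (k - i - 1))%:~R :> R.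
  rewrite ler0z; have [le_ki|lt_ik] := leP k i.
    by rewrite mulr_le0//; lia.
  by rewrite mulr_ge0//; lia.
by rewrite intrM !intrB; nra.
Qed.

Lemma parabola_midpoint_above (R : realType) (k l : int) : k != l ->
  ((k + l)%:~R / 2) ^+ 2 <
  midpoint (parabola_point R k) (parabola_point R l) ord0 ord_max.
Proof.
move=> neq_kl; rewrite midpointE !mxE /= intrD.
have : 0 < (k%:~R - l%:~R) ^+ 2 :> R.
  by rewrite exprn_even_gt0//= subr_eq0 eqr_int.
lra.
Qed.

(** Consecutive integer points have their midpoint on the interpolation; even
    abscissae avoid this, and make the abscissa of the midpoint an integer, as
    [below_chord_integer] requires. *)
Lemma parabola_chords_not_MICPR (R : realType) (S : set 'rV[R]_2) :
  (forall i, S (parabola_point R i)) ->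
  S `<=` \bigcup_(i in [set: int])
      conv_hull [set parabola_point R i; parabola_point R (i + 1)] ->
  ~ MICP_representable S.
Proof.
move=> Sparabola Schords.
apply: (@midpoint_obstruction_seq _ _ _ (fun k => parabola_point R (2 * k%:Z))).
  by move=> k; exact: Sparabola.
move=> k l neq_kl /Schords[i _ /conv_hull_below_chord].
move/(@below_chord_integer _ _ (k%:Z + l%:Z)) => below.
have neq2_kl : 2 * k%:Z != 2 * l%:Z by apply/eqP; lia.
have := parabola_midpoint_above R neq2_kl; apply/negP; rewrite -leNgt.
rewrite -mulrDr intrM mulrAC mulfV ?mul1r// below//.
by rewrite midpointE !mxE /= !intrM -mulrDr mulrAC mulfV ?mul1r ?intrD.
Qed.

Theorem corollary4p1 (R : realType) :
  [/\ (forall m n : nat, (2 <= m)%N -> (2 <= n)%N ->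
         ~ MICP_representable
             (mxvec @` [set X : 'M[R]_(m, n) | (\rank X <= 1)%N])),
      (forall (n : nat) (K : set 'rV[R]_n), (2 <= n)%N ->
         convex_body K -> strictly_convex K -> ~ MICP_representable (~` K)),
      (forall n : nat, (2 <= n)%N ->
         ~ MICP_representable [set x : 'rV[R]_n | 1 <= enorm x <= 2]),
      ~ MICP_representable
          (\bigcup_(i in [set: int])
             [set parabola_point R i; parabola_point R (i + 1)])
    & ~ MICP_representable
          (\bigcup_(i in [set: int])
             conv_hull [set parabola_point R i; parabola_point R (i + 1)])].
Proof.
split.
- exact: rank1_not_MICPR.
- exact: strictly_convex_compl_not_MICPR.
- exact: shell_not_MICPR.
- apply: parabola_chords_not_MICPR => [i|x [i _ xi]].
    by exists i => //; left.
  by exists i => //; exact: sub_gen_smallest.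
- apply: parabola_chords_not_MICPR => // i.
  by exists i => //; apply: sub_gen_smallest; left.
Qed.
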